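(* Let $r$ be a line in $\mathbb{P}^2_{\mathbb{C}}$ and let $1,\dots,6$ be distinct points of $r$. Let $\mathcal{L}=\{\ell_{123},\ell_{156},\ell_{246},\ell_{345}\}$, where $\ell_{ijk}$ is the combinatorial line consisting of the points $i,j,k$. Let $\{R_1,R_2,R_3,U\}$ be a frame of reference of $\mathbb{P}^2_{\mathbb{C}}$. Then the following statements are equivalent: (i) The points $1,\dots,6$ are the projective image of a quadrilateral set. (ii) The polynomials $QS(\ell;P^1,P^2,P^3)$ vanish for any $\ell\in\mathcal{L}$ and any $P^1,P^2,P^3\in\mathbb{P}^2_{\mathbb{C}}$. (iii) The polynomials $QS(\ell;R_i,R_j,R_k)$ vanish for any $\ell\in\mathcal{L}$ and any $(i,j,k)\in\{1,2,3\}^3$. (iv) The polynomials $QS(\ell_{123};R_i,R_j,R_k)$ vanish for any $(i,j,k)\in\{1,2,3\}^3$. (v) The polynomials $QS(\ell_{123};R_i,R_j,R_k)$ vanish for any $(i,j,k)\in\{1,2,3\}^3$ with $i\le j\le k$.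
   Context: A quadrilateral set in $\mathbb{P}^2_{\mathbb{C}}$ consists of four lines and their six (pairwise distinct) intersection points. Its points are labelled $1,\dots,6$ so that the four lines contain the triples $\{1,2,3\},\{1,5,6\},\{2,4,6\},\{3,4,5\}$. The points $1,\dots,6$ of $r$ are the projective image of a quadrilateral set if there are a point $P\notin r$ and a quadrilateral set with points $p_1,\dots,p_6$ labelled in this way such that the projection from $P$ onto $r$ maps $p_i$ to the point $i$ for every $i$. Brackets: $[a\,b\,c]$ is the determinant of the $3\times3$ matrix whose columns are chosen homogeneous coordinate vectors of $a,b,c$; the vanishing of the polynomials below does not depend on the chosen representatives. $R_1,R_2,R_3$ are represented by linearly independent vectors whose sum represents $U$. For $\ell\in\mathcal{L}$ with points $P_\ell^1,P_\ell^2,P_\ell^3$ (in a fixed order), let $P_m^1,P_m^2,P_m^3$ be the three points not on $\ell$, labelled so that $\{P_\ell^1,P_m^1,P_m^2\}$, $\{P_\ell^2,P_m^2,P_m^3\}$, $\{P_\ell^3,P_m^1,P_m^3\}$ are the other three combinatorial lines. Then $$QS(\ell;P^1,P^2,P^3)=[P_\ell^1P_m^1P^1][P_\ell^2P_m^2P^2][P_\ell^3P_m^3P^3]-[P_\ell^1P_m^2P^1][P_\ell^2P_m^3P^2][P_\ell^3P_m^1P^3].$$ In particular $QS(\ell_{123};P^1,P^2,P^3)=[1\,5\,P^1][2\,6\,P^2][3\,4\,P^3]-[1\,6\,P^1][2\,4\,P^2][3\,5\,P^3]$. *)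

(* Defs.v *)
From HB Require Import structures.
From mathcomp Require Import all_boot all_order all_algebra.
From mathcomp Require Import reals.
From mathcomp Require Export complex.

Set Implicit Arguments.
Unset Strict Implicit.
Unset Printing Implicit Defensive.

Import GRing.Theory.
Local Open Scope ring_scope.

(* P^2_F is the set of 1-dimensional subspaces of F^3, and its lines are the
   2-dimensional subspaces of F^3; "P lies on l" is (P <= l)%VS. *)
Record point (F : fieldType) := Point {
  point_space :> {vspace 'cV[F]_3};
  point_dim : \dim point_space == 1%N }.

HB.instance Definition _ (F : fieldType) := [isSub for @point_space F].
HB.instance Definition _ (F : fieldType) := [Equality of point F by <:].

Record line (F : fieldType) := Line {
  line_space :> {vspace 'cV[F]_3};
  line_dim : \dim line_space == 2%N }.

HB.instance Definition _ (F : fieldType) := [isSub for @line_space F].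
HB.instance Definition _ (F : fieldType) := [Equality of line F by <:].

(* The labels 1, ..., 6; label n is the ordinal n - 1. *)
Definition i1 : 'I_6 := @Ordinal 6 0 isT.
Definition i2 : 'I_6 := @Ordinal 6 1 isT.
Definition i3 : 'I_6 := @Ordinal 6 2 isT.
Definition i4 : 'I_6 := @Ordinal 6 3 isT.
Definition i5 : 'I_6 := @Ordinal 6 4 isT.
Definition i6 : 'I_6 := @Ordinal 6 5 isT.

(* The set L of combinatorial lines, enumerated. *)
Definition combinatorial_line (l : 'I_4) : {set 'I_6} :=
  tnth [tuple [set i1; i2; i3]; [set i1; i5; i6]; [set i2; i4; i6];
              [set i3; i4; i5]] l.

Definition l123 : 'I_4 := @Ordinal 4 0 isT.

Section Geometry.
Variable F : fieldType.
Implicit Types (P Q U : point F) (r : line F) (p : 'I_6 -> point F).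

Definition quadrilateral_set (k : 'I_4 -> line F) p : Prop :=
  [/\ injective k, injective p
    & forall P, (exists i, p i = P) <->
        (exists a b : 'I_4, a != b /\ (k a :&: k b)%VS = P :> {vspace _})].

Definition labelled_quadrilateral_set p : Prop :=
  exists2 k : 'I_4 -> line F, quadrilateral_set k p &
    forall l i, i \in combinatorial_line l -> (p i <= k l)%VS.

(* X is the image of Q under the projection from P onto r, which is defined
   at the points other than P: X is where the line PQ meets r. *)
Definition projects_to P r Q (X : point F) : Prop :=
  Q != P /\ ((P + Q) :&: r)%VS = X :> {vspace _}.

Definition projective_image_of_quadrilateral_set r (x : 'I_6 -> point F) :
    Prop :=
  exists P, ~~ (P <= r)%VS /\
    exists2 p, labelled_quadrilateral_set p &
      forall i, projects_to P r (p i) (x i).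

Definition homogeneous_coordinates (h : point F -> 'cV[F]_3) : Prop :=
  forall P, h P != 0 /\ h P \in (P : {vspace _}).

Definition frame_of_reference (R_ : 'I_3 -> point F) U : Prop :=
  exists v : 3.-tuple 'cV[F]_3,
    [/\ free v, forall i, <[tnth v i]>%VS = R_ i :> {vspace _}
      & <[\sum_i tnth v i]>%VS = U :> {vspace _}].

Definition bracket (h : point F -> 'cV[F]_3) (a b c : point F) : F :=
  \det (row_mx (h a) (row_mx (h b) (h c)) : 'M[F]_3).

(* pl gives the order (P_l^1, P_l^2, P_l^3) of the points on the line l and
   pm the resulting labelling (P_m^1, P_m^2, P_m^3) of the other points. *)
Definition QS_labelling (l : 'I_4) (pl pm : 'I_3 -> 'I_6) : Prop :=
  [/\ [set pl s | s : 'I_3] = combinatorial_line l,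
      [set pm s | s : 'I_3] = ~: combinatorial_line l
    & [set [set pl 0; pm 0; pm 1]; [set pl 1; pm 1; pm 2];
           [set pl 2; pm 0; pm 2]]
      = [set combinatorial_line l' | l' in [set~ l]] ].

Definition QS (h : point F -> 'cV[F]_3) (x : 'I_6 -> point F)
    (pl pm : 'I_3 -> 'I_6) (P1 P2 P3 : point F) : F :=
  let br i j P := bracket h (x i) (x j) P in
  br (pl 0) (pm 0) P1 * br (pl 1) (pm 1) P2 * br (pl 2) (pm 2) P3
  - br (pl 0) (pm 1) P1 * br (pl 1) (pm 2) P2 * br (pl 2) (pm 0) P3.

End Geometry.

(* Listing each line increasingly is an admissible choice; for l123 it gives
   [1 5 P1][2 6 P2][3 4 P3] - [1 6 P1][2 4 P2][3 5 P3]. *)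
Definition increasing_on (l : 'I_4) (s : 'I_3) : 'I_6 :=
  tnth (tnth [tuple [tuple i1; i2; i3]; [tuple i1; i5; i6];
                    [tuple i2; i4; i6]; [tuple i3; i4; i5]] l) s.

Definition increasing_off (l : 'I_4) (s : 'I_3) : 'I_6 :=
  tnth (tnth [tuple [tuple i5; i6; i4]; [tuple i2; i3; i4];
                    [tuple i1; i3; i5]; [tuple i1; i2; i6]] l) s.

Lemma increasing_labelling l :
  QS_labelling l (increasing_on l) (increasing_off l).
Proof.
have E3 (T : finType) (f : 'I_3 -> T) : [set f s | s : 'I_3] = [set f 0; f 1; f 2].
  apply/setP=> t; rewrite !inE; apply/imsetP/idP => [[s _ ->]|].
    by case: s => [[|[|[|//]]] sP]; rewrite -?orbA; apply/or3P;
      [apply: Or31|apply: Or32|apply: Or33]; apply/eqP; congr f; apply/val_inj.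
  by case/orP=> [/orP[]|] /eqP->; [exists 0|exists 1|exists 2].
split; rewrite ?E3.
- by case: l => [[|[|[|[|//]]]] lP].
- by case: l => [[|[|[|[|//]]]] lP]; apply/setP=> i; rewrite !inE;
    case: i => [[|[|[|[|[|[|//]]]]]] iP].
have img a b c : [set~ l] = [set a; b; c] ->
    [set combinatorial_line l' | l' in [set~ l]]
    = [set combinatorial_line a; combinatorial_line b; combinatorial_line c].
  by move=> ->; rewrite !imsetU !imset_set1.
have eq3 (a b c d e f : {set 'I_6}) :
    a = d -> b = e -> c = f -> [set a; b; c] = [set d; e; f].
  by move=> -> -> ->.
case: l img => [[|[|[|[|//]]]] lP] img.
- rewrite (img (@Ordinal 4 1 isT) (@Ordinal 4 2 isT) (@Ordinal 4 3 isT)).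
    by apply: eq3; apply/setP=> -[[|[|[|[|[|[|//]]]]]] iP]; rewrite !inE.
  by apply/setP=> -[[|[|[|[|//]]]] jP]; rewrite !inE.
- rewrite (img (@Ordinal 4 0 isT) (@Ordinal 4 3 isT) (@Ordinal 4 2 isT)).
    by apply: eq3; apply/setP=> -[[|[|[|[|[|[|//]]]]]] iP]; rewrite !inE.
  by apply/setP=> -[[|[|[|[|//]]]] jP]; rewrite !inE.
- rewrite (img (@Ordinal 4 0 isT) (@Ordinal 4 3 isT) (@Ordinal 4 1 isT)).
    by apply: eq3; apply/setP=> -[[|[|[|[|[|[|//]]]]]] iP]; rewrite !inE.
  by apply/setP=> -[[|[|[|[|//]]]] jP]; rewrite !inE.
- rewrite (img (@Ordinal 4 0 isT) (@Ordinal 4 2 isT) (@Ordinal 4 1 isT)).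
    by apply: eq3; apply/setP=> -[[|[|[|[|[|[|//]]]]]] iP]; rewrite !inE.
  by apply/setP=> -[[|[|[|[|//]]]] jP]; rewrite !inE.
Qed.

Lemma QS_l123E (F : fieldType) h (x : 'I_6 -> point F) P1 P2 P3 :
  let br i j P := bracket h (x i) (x j) P in
  QS h x (increasing_on l123) (increasing_off l123) P1 P2 P3 =
    br i1 i5 P1 * br i2 i6 P2 * br i3 i4 P3
    - br i1 i6 P1 * br i2 i4 P2 * br i3 i5 P3.
Proof. by []. Qed.

(* Main.v *)
Require Import Defs.
From mathcomp Require Import all_boot all_order all_algebra.
From mathcomp Require Import reals ring.
Import GRing.Theory.
Local Open Scope ring_scope.
Local Open Scope complex_scope.

Set Implicit Arguments.
Unset Strict Implicit.
Unset Printing Implicit Defensive.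

(* Let e1, e2 be a basis of r and let [i j] be the 2 x 2 bracket of the
   coordinates of the points i and j. Then QS is the product of a form
   q = [1 5][2 6][3 4] - [1 6][2 4][3 5] in the brackets, with labels depending
   on the line, and of the nonzero multiples of the equation of r evaluated at
   P^1, P^2, P^3. Up to sign q depends only on the pairs {1,4}, {2,5}, {3,6} of
   opposite vertices: it is the determinant of the three binary quadratic forms
   vanishing at these pairs (they belong to an involution iff q = 0). So
   (ii)-(v) are all equivalent to q = 0, as some R_i lies off r.
   A lift of the points i from P is given by vectors x_i + c_i w with w in P, and
   the four collinearities are linear equations in c. They imply
   q * det(1,2,6) = 0, whence (i) gives q = 0. Conversely, if q = 0, they have
   the solution c = (0, 0, 0, [1 6][2 4]/[2 6], [1 5], [1 6]), whose line
   through 1, 2, 3 is r itself. *)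

(** * Determinants and independence of three coordinate vectors *)

Section PlaneVectors.
Variable F : fieldType.
Implicit Types (u v w e : 'cV[F]_3) (P Q : point F) (l m : line F).

Definition det3 u v w : F := \det (row_mx u (row_mx v w) : 'M[F]_3).

Lemma row_mx3E u v w i j :
  (row_mx u (row_mx v w) : 'M[F]_3) i j = [:: u; v; w]`_j i 0.
Proof.
rewrite mxE; case: splitP => k /= ->; first by rewrite !ord1.
by rewrite mxE; case: splitP => k' /= ->; rewrite !ord1.
Qed.

Lemma det3E u v w :
  det3 u v w = u 0 0 * (v 1 0 * w 2%:R 0 - v 2%:R 0 * w 1 0)
             - v 0 0 * (u 1 0 * w 2%:R 0 - u 2%:R 0 * w 1 0)
             + w 0 0 * (u 1 0 * v 2%:R 0 - u 2%:R 0 * v 1 0).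
Proof.
rewrite /det3; pose A : 'M[F]_3 := row_mx u (row_mx v w); rewrite -/A.
have AE : forall i j, A i j = [:: u; v; w]`_j i 0 := row_mx3E u v w.
clearbody A.
rewrite (expand_det_row _ 0) !big_ord_recl big_ord0 /cofactor.
rewrite !(expand_det_row _ 0) !big_ord_recl !big_ord0 /cofactor !det_mx11.
rewrite !mxE !AE /=.
rewrite (_ : lift 0 (lift 0 0) = 2%:R :> 'I_3); last exact/val_inj.
rewrite (_ : lift 0 0 = 1 :> 'I_3); last exact/val_inj.
ring.
Qed.

(** A row vector multiplied by the transposed matrix yields the linear combination of [u], [v], [w]
    with those coefficients, so kernel vectors are exactly linear relations. *)
Lemma det3_free u v w : (det3 u v w != 0) = free [:: u; v; w].
Proof.
rewrite /det3; pose A : 'M[F]_3 := row_mx u (row_mx v w); rewrite -/A.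
have BE : forall i j, A i j = [:: u; v; w]`_j i 0 := row_mx3E u v w.
clearbody A.
have AE (k : 'rV[F]_3) : k *m A^T = (\sum_i k 0 i *: [:: u; v; w]`_i)^T.
  apply/rowP=> j; rewrite !mxE !big_ord_recl !big_ord0 !mxE /=.
  by rewrite !BE.
rewrite -det_tr; apply/idP/(@freeP _ _ _ [tuple u; v; w]) => [dA k k0|kP].
  have/det0P nA := dA => i; apply/eqP/negPn/negP => ki; apply: nA.
  exists (\row_j k j); first by apply: contraNneq ki => /rowP/(_ i); rewrite !mxE => ->.
  by rewrite AE; under eq_bigr do rewrite mxE; rewrite k0 trmx0.
apply/negP=> /det0P[k k0]; rewrite AE => /(congr1 trmx); rewrite trmxK trmx0.
by move=> /kP kk; case/eqP: k0; apply/rowP=> i; rewrite kk mxE.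
Qed.

End PlaneVectors.

(** * Combinatorics of the four lines and six vertices *)

Lemma in_combinatorial_line l (i : 'I_6) : (i \in combinatorial_line l) =
  ((i : nat) \in
    nth [::] [:: [:: 0; 1; 2]; [:: 0; 4; 5]; [:: 1; 3; 5]; [:: 2; 3; 4]] l)%N.
Proof.
by case: l => [[|[|[|[|//]]]] lP]; case: i => [[|[|[|[|[|[|//]]]]]] iP]; rewrite !inE.
Qed.

Lemma card_combinatorial_line l : #|combinatorial_line l| = 3%N.
Proof.
by case: l => [[|[|[|[|//]]]] lP];
  rewrite /combinatorial_line /tnth /= -setUA !cardsU1 cards1 !inE.
Qed.

(* [i + 3], computed modulo 6, is the vertex opposite to [i]. *)
Lemma common_line (i j : 'I_6) : j != i + 3%:R ->
  exists l, (i \in combinatorial_line l) && (j \in combinatorial_line l).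
Proof.
suff /forallP/(_ i)/forallP/(_ j)/implyP h : [forall i : 'I_6, forall j : 'I_6,
    (j != i + 3%:R) ==>
      [exists l, (i \in combinatorial_line l) && (j \in combinatorial_line l)]].
  by move/h/existsP.
apply/forallP=> -[[|[|[|[|[|[|//]]]]]] iP]; apply/forallP=> -[[|[|[|[|[|[|//]]]]]] jP];
  apply/implyP=> // _; apply/existsP;
  by [exists (@Ordinal 4 0 isT); rewrite !in_combinatorial_line
     |exists (@Ordinal 4 1 isT); rewrite !in_combinatorial_line
     |exists (@Ordinal 4 2 isT); rewrite !in_combinatorial_line
     |exists (@Ordinal 4 3 isT); rewrite !in_combinatorial_line].
Qed.

Lemma common_point (l m : 'I_4) : l != m ->
  exists i, (i \in combinatorial_line l) && (i \in combinatorial_line m).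
Proof.
case: l m => [[|[|[|[|//]]]] lP] [[|[|[|[|//]]]] mP] // _;
  by [exists i1; rewrite !in_combinatorial_line|exists i2; rewrite !in_combinatorial_line
     |exists i3; rewrite !in_combinatorial_line|exists i4; rewrite !in_combinatorial_line
     |exists i5; rewrite !in_combinatorial_line|exists i6; rewrite !in_combinatorial_line].
Qed.

Lemma two_lines (i : 'I_6) : exists l m : 'I_4,
  [/\ l != m, i \in combinatorial_line l & i \in combinatorial_line m].
Proof.
pose o k (kP : (k < 4)%N) := Ordinal kP.
case: i => [[|[|[|[|[|[|//]]]]]] iP];
  [exists (o 0%N isT), (o 1%N isT)|exists (o 0%N isT), (o 2%N isT)
  |exists (o 0%N isT), (o 3%N isT)|exists (o 2%N isT), (o 3%N isT)
  |exists (o 1%N isT), (o 3%N isT)|exists (o 1%N isT), (o 2%N isT)];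
  by rewrite !in_combinatorial_line.
Qed.

Lemma QS_labelling_inj l pl pm : QS_labelling l pl pm -> injective pl /\ injective pm.
Proof.
have inj (f : 'I_3 -> 'I_6) : #|[set f s | s : 'I_3]| = 3%N -> injective f.
  move=> f3; have /imset_injP fI : #|[set f s | s : 'I_3]| == #|'I_3|.
    by rewrite f3 card_ord.
  by move=> s t; apply: fI.
move=> [plE pmE _]; split; apply: inj; first by rewrite plE card_combinatorial_line.
by rewrite pmE cardsCs setCK card_ord card_combinatorial_line.
Qed.

(** Labels without a common line are opposite. The three lines other than [l] join each [pl s] to
    just two of the [pm t], and [l] contains no [pm t]; the third [pm t] must then be opposite to
    [pl s]. *)
Lemma QS_labelling_opposite l pl pm : QS_labelling l pl pm ->
  [/\ pm 2%:R = pl 0 + 3%:R, pm 0 = pl 1 + 3%:R & pm 1 = pl 2%:R + 3%:R].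
Proof.
move=> lab; have [plI pmI] := QS_labelling_inj lab; case: lab => plE pmE linesE.
have pl_on s : pl s \in combinatorial_line l by rewrite -plE imset_f.
have pm_off s : pm s \notin combinatorial_line l.
  by rewrite -[_ \in _]negbK -in_setC -pmE imset_f.
have pl_pm s t : (pl s == pm t) = false.
  by apply/eqP=> e; move: (pm_off t); rewrite -e pl_on.
have pm_pl s t : (pm s == pl t) = false by rewrite eq_sym.
(* A line through [pl s] and [pm t] differs from [l], as [pm t] is off [l]; it is thus one of the
   three displayed triples. *)
have opp s t :
    ~~ [exists X in [set [set pl 0; pm 0; pm 1]; [set pl 1; pm 1; pm 2%:R];
           [set pl 2%:R; pm 0; pm 2%:R]], (pl s \in X) && (pm t \in X)] ->
    pm t = pl s + 3%:R.
  rewrite linesE => /existsP no; apply/eqP/negPn/negP => /common_line[m] m_st.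
  apply: no; exists (combinatorial_line m); rewrite m_st andbT imset_f // !inE.
  by apply: contraL m_st => /eqP ->; rewrite (negPf (pm_off t)) andbF.
have E := (pl_pm, pm_pl, inj_eq plI, inj_eq pmI).
by split; apply: opp; apply/existsP=> -[X]; rewrite !inE -orbA => /andP[/or3P[]/eqP->];
  rewrite !inE !E.
Qed.

(** * The form q on the line and its invariance under relabelling *)

Section InvolutionCriterion.
Variables (F : fieldType) (a b : 'I_6 -> F).

Definition br2 i j : F := a i * b j - a j * b i.

Definition qs2 (pl pm : 'I_3 -> 'I_6) : F :=
  br2 (pl 0) (pm 0) * br2 (pl 1) (pm 1) * br2 (pl 2%:R) (pm 2%:R)
  - br2 (pl 0) (pm 1) * br2 (pl 1) (pm 2%:R) * br2 (pl 2%:R) (pm 0).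

(* Up to signs and order, the coefficients of the binary quadratic form vanishing
   at [i] and its opposite. *)
Definition pair_form (i : 'I_6) : 'cV[F]_3 :=
  let j := i + 3%:R in
  \col_k [:: a i * a j; a i * b j + a j * b i; b i * b j]`_k.

Lemma pair_form_opposite i : pair_form (i + 3%:R) = pair_form i.
Proof.
rewrite /pair_form (_ : i + 3%:R + 3%:R = i); last first.
  by rewrite -addrA (_ : 3%:R + 3%:R = 0 :> 'I_6) ?addr0; last exact/val_inj.
by congr (\col_k _`_k); rewrite ?[a i * a _]mulrC ?[b i * b _]mulrC ?[_ + a i * _]addrC. 
Qed.

Lemma qs2_pair_form l pl pm : QS_labelling l pl pm ->
  qs2 pl pm = - det3 (pair_form (pl 0)) (pair_form (pl 1)) (pair_form (pl 2%:R)).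
Proof.
move=> /QS_labelling_opposite[e2 e0 e1].
by rewrite /qs2 /br2 e0 e1 e2 det3E !mxE /=; ring.
Qed.

(** Each line contains exactly one label of every opposite pair, so the three forms are always the
    same up to order. Comparing freeness instead of determinants absorbs the sign of the
    permutation. *)
Lemma qs2_labelling l l' pl pm pl' pm' :
  QS_labelling l pl pm -> QS_labelling l' pl' pm' ->
  (qs2 pl pm == 0) = (qs2 pl' pm' == 0).
Proof.
suff key k p q : QS_labelling k p q ->
    (qs2 p q != 0) = free [seq pair_form (inord n) | n <- iota 0 3].
  by move=> L L'; apply/negb_inj; rewrite (key _ _ _ L) (key _ _ _ L').
move=> L; rewrite (qs2_pair_form L) oppr_eq0 det3_free.
have [pI qI] := QS_labelling_inj L; have [q2 q0 q1] := QS_labelling_opposite L.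
have pair_mod3 i : pair_form i = pair_form (inord (i %% 3)).
  case: (ltnP i 3) => i3; first by rewrite modn_small // inord_val.
  rewrite -[LHS]pair_form_opposite; congr pair_form; apply/val_inj.
  rewrite /= inordK; first by move: i3; case: i => [[|[|[|[|[|[|//]]]]]] iP].
  exact: leq_trans (ltn_pmod _ _) _.
rewrite [pair_form (p 0)]pair_mod3 [pair_form (p 1)]pair_mod3 [pair_form (p _)]pair_mod3.
have mod3_inj (i j : 'I_6) : (i %% 3 = j %% 3)%N -> i = j \/ i = j + 3%:R.
  case: i j => [[|[|[|[|[|[|//]]]]]] iP] [[|[|[|[|[|[|//]]]]]] jP] //= _;
  by [left; exact/val_inj|right; exact/val_inj].
(* Residues modulo 3 name the opposite pairs. The opposite of [p t] is one of the [q u], hence off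
   the line, and cannot be [p s]. *)
have p_mod3 s t : s != t -> (p s %% 3 != p t %% 3)%N.
  apply: contraNneq => /mod3_inj[/pI -> //|pst]; case: L => pE qE _.
  have [u qu] : exists u, q u = p t + 3%:R.
    case: t pst => [[|[|[|//]]] tP] _; [exists 2%:R; rewrite q2|exists 0; rewrite q0
     |exists 1; rewrite q1]; congr (p _ + _); exact/val_inj.
  have : q u \in ~: combinatorial_line k by rewrite -qE imset_f.
  by rewrite inE qu -pst -pE imset_f.
have pP : perm_eq [:: p 0%R %% 3; p 1%R %% 3; p 2%:R%R %% 3]%N (iota 0 3).
  have pU : uniq [:: p 0%R %% 3; p 1%R %% 3; p 2%:R%R %% 3]%N.
    by rewrite /= !inE negb_or !p_mod3.
  apply: uniq_perm => //; apply: (uniq_min_size _ _ _).2 => //.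
  by move=> n; rewrite mem_iota !inE => /or3P[] /eqP->; rewrite ltn_mod.
exact: (perm_free (perm_map (fun n => pair_form (inord n)) pP)).
Qed.

End InvolutionCriterion.

(** * Incidence of points and lines by determinants *)

Section Incidence.
Variable F : fieldType.
Implicit Types (u v w : 'cV[F]_3) (P Q : point F) (l m : line F).

Lemma det3_coplanar (V : {vspace 'cV[F]_3}) u v w : (\dim V <= 2)%N ->
  u \in V -> v \in V -> w \in V -> det3 u v w = 0.
Proof.
move=> V2 uV vV wV; apply/eqP; apply: contraLR V2.
rewrite det3_free => /eqP uvw; rewrite -ltnNge.
apply: leq_trans (eq_leq (esym uvw)) _; apply/dimvS/span_subvP => z.
by rewrite !inE => /or3P[] /eqP->.
Qed.

Lemma det3_free2 u v w : det3 u v w != 0 -> free [:: u; v].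
Proof. by rewrite det3_free -[[:: u; v; w]]/([:: u; v] ++ [:: w]) => /catl_free. Qed.

Lemma line_span l u v : free [:: u; v] -> u \in l -> v \in l ->
  l = <<[:: u; v]>>%VS :> {vspace _}.
Proof.
move=> uv ul vl; apply/eqP; rewrite eq_sym eqEdim (eqP uv) (eqP (line_dim l)) andbT.
by apply/span_subvP => z; rewrite !inE => /orP[] /eqP->.
Qed.

Lemma mem_line_det3 l u v w : free [:: u; v] -> u \in l -> v \in l ->
  (w \in l) = (det3 u v w == 0).
Proof.
move=> uv ul vl; apply/negb_inj; rewrite det3_free (line_span uv ul vl).
rewrite -(perm_free (permEl (perm_catC [:: w] [:: u; v]))) /=.
by rewrite [in RHS]free_cons uv andbT.
Qed.

Definition span_line u v (uv : free [:: u; v]) : line F := @Line F <<[:: u; v]>> uv.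

Definition span_point u (u0 : u != 0) : point F :=
  @Point F <[u]> (introT eqP (etrans (dim_vline u) (congr1 nat_of_bool u0))).

Lemma meet_lines l m P : l <> m -> (P <= l)%VS -> (P <= m)%VS ->
  (l :&: m)%VS = P :> {vspace _}.
Proof.
move=> lm Pl Pm; apply/eqP; rewrite eq_sym eqEdim subv_cap Pl Pm (eqP (point_dim P)) /=.
rewrite leqNgt; apply/negP => d2; apply: lm; apply/val_inj => /=.
have cap (k : line F) : (l :&: m <= k)%VS -> (l :&: m)%VS = k :> {vspace _}.
  by move=> s; apply/eqP; rewrite eqEdim s (eqP (line_dim k)).
by rewrite -(cap l) ?capvSl // (cap m) ?capvSr.
Qed.

Lemma point_span P u : u != 0 -> u \in (P : {vspace _}) -> P = <[u]>%VS :> {vspace _}.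
Proof.
move=> u0 uP; apply/eqP.
by rewrite eq_sym eqEdim -memvE uP dim_vline u0 (eqP (point_dim P)).
Qed.

Lemma point_eq P Q u :
  u != 0 -> u \in (P : {vspace _}) -> u \in (Q : {vspace _}) -> P = Q.
Proof.
move=> u0 uP uQ; apply/val_inj.
by rewrite /= (point_span u0 uP) (point_span u0 uQ).
Qed.

Lemma sub_pointP P l u : u != 0 -> u \in (P : {vspace _}) -> (P <= l)%VS = (u \in l).
Proof. by move=> u0 uP; rewrite (point_span u0 uP) memvE. Qed.

End Incidence.

(** This serves to separate the lines of the constructed quadrilateral: its vertices 1, 2, 3 lie on
    [r] and the other three do not, so no line contains such [i], [j], [n] together. *)
Lemma two_on_first_line (l m : 'I_4) : l != m -> exists i j n : 'I_6,
  [/\ (i < 3)%N, (j < 3)%N, i != j, (3 <= n)%N &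
   {in [:: i; j; n], forall t,
      (t \in combinatorial_line l) || (t \in combinatorial_line m)}].
Proof.
have W (i j n : 'I_6) : (i < 3)%N -> (j < 3)%N -> i != j -> (3 <= n)%N ->
    all (fun t => (t \in combinatorial_line l) || (t \in combinatorial_line m))
      [:: i; j; n] ->
    exists i j n : 'I_6, [/\ (i < 3)%N, (j < 3)%N, i != j, (3 <= n)%N &
      {in [:: i; j; n], forall t,
         (t \in combinatorial_line l) || (t \in combinatorial_line m)}].
  by move=> i_lt j_lt ij n_ge /allP on; exists i, j, n.
case: l m W => [[|[|[|[|//]]]] lP] [[|[|[|[|//]]]] mP] W // _;
  by [apply: (W i1 i2 i4); rewrite //= !in_combinatorial_line
     |apply: (W i1 i2 i5); rewrite //= !in_combinatorial_line
     |apply: (W i1 i3 i4); rewrite //= !in_combinatorial_line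
     |apply: (W i1 i3 i5); rewrite //= !in_combinatorial_line
     |apply: (W i2 i3 i4); rewrite //= !in_combinatorial_line
     |apply: (W i2 i3 i5); rewrite //= !in_combinatorial_line].
Qed.

(** * Lifting the six points of [r] from a centre off [r] *)

Section Configuration.
Variables (F : fieldType) (r : line F) (x : 'I_6 -> point F).
Variables (e1 e2 : 'cV[F]_3) (a b : 'I_6 -> F).
Let xv i := a i *: e1 + b i *: e2.
Hypotheses (e_free : free [:: e1; e2]) (e1r : e1 \in r) (e2r : e2 \in r).
Hypothesis xvx : forall i, xv i \in (x i : {vspace _}).
Hypothesis br_neq0 : forall i j, i != j -> br2 a b i j != 0.

Local Notation "[ i j ]" := (br2 a b i j) (i at level 0, j at level 0).
Let q123 := qs2 a b (increasing_on l123) (increasing_off l123).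

Let y c w i := xv i + c i *: w.

(** The first factor is the determinant of the coordinates [(a, b, c)] relative to [e1], [e2], [w].
    For [w] off [r], collinearity of lifts is therefore a linear equation in [c]. *)
Lemma det3_lift c w i j k : det3 (y c w i) (y c w j) (y c w k) =
  ([i j] * c k - [i k] * c j + [j k] * c i) * det3 e1 e2 w.
Proof.
by rewrite /y /xv /br2 !det3E !mxE; ring.
Qed.

Lemma det3_liftw c w i j : det3 (y c w i) (y c w j) w = [i j] * det3 e1 e2 w.
Proof. by rewrite /y /xv /br2 !det3E !mxE; ring. Qed.

Lemma qs2_collinear (c : 'I_6 -> F)
    (D := fun i j k => [i j] * c k - [i k] * c j + [j k] * c i) :
  D i1 i2 i3 = 0 -> D i1 i5 i6 = 0 -> D i2 i4 i6 = 0 -> D i3 i4 i5 = 0 ->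
  D i1 i2 i6 != 0 -> q123 = 0.
Proof.
move=> D123 D156 D246 D345 D126.
have n i j := br_neq0 (i := i) (j := j).
(* Cramer's relation between four vectors of the lifted plane, bracketed
   with [t] and the centre of projection. *)
have syz t i j k l :
    D j k l * [i t] - D i k l * [j t] + D i j l * [k t] - D i j k * [l t] = 0.
  by rewrite /D /br2; ring.
(* In each use of [syz] below, [t] is one of the four labels, so its own term vanishes; a
   collinearity hypothesis removes another, leaving a two-term relation. *)
have h1 : D i1 i2 i5 * [i1 i6] = D i1 i2 i6 * [i1 i5].
  by apply/subr0_eq; rewrite -(syz i1 i1 i2 i5 i6) D156 /br2; ring.
have h2 : D i1 i2 i4 * [i2 i6] = D i1 i2 i6 * [i2 i4].
  by apply/subr0_eq; rewrite -(syz i2 i1 i2 i4 i6) D246 /br2; ring.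
have h3 : D i2 i3 i5 * [i3 i4] = D i2 i3 i4 * [i3 i5].
  by apply/esym/subr0_eq; rewrite -(syz i3 i2 i3 i4 i5) D345 /br2; ring.
have h4 : D i2 i3 i5 * [i1 i2] = D i1 i2 i5 * [i2 i3].
  by apply/subr0_eq; rewrite -(syz i2 i1 i2 i3 i5) D123 /br2; ring.
have h5 : D i2 i3 i4 * [i1 i2] = D i1 i2 i4 * [i2 i3].
  by apply/subr0_eq; rewrite -(syz i2 i1 i2 i3 i4) D123 /br2; ring.
have h6 : D i1 i2 i5 * [i3 i4] = D i1 i2 i4 * [i3 i5].
  by apply: (mulIf (n i2 i3 isT)); rewrite mulrAC -h4 [RHS]mulrAC -h5 mulrAC h3 mulrAC.
(* After multiplication by [D i1 i2 i6], [h1] and [h2] extract the factor [[i1 i6] * [i2 i6]], and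
   [h6] annihilates what remains. *)
apply/eqP; rewrite -(mulrI_eq0 _ (mulfI D126)); apply/eqP.
transitivity (D i1 i2 i6 * [i1 i5] * [i2 i6] * [i3 i4]
              - D i1 i2 i6 * [i2 i4] * [i1 i6] * [i3 i5]).
  by rewrite /q123 /qs2 /=; ring.
rewrite -h1 -h2.
transitivity ([i1 i6] * [i2 i6]
              * (D i1 i2 i5 * [i3 i4] - D i1 i2 i4 * [i3 i5])).
  by ring.
by rewrite h6 subrr mulr0.
Qed.

Lemma lift_neq0 c w i : det3 e1 e2 w != 0 -> y c w i != 0.
Proof.
move=> d0; have [j ij] : exists j, i != j.
  by case: (eqVneq i i1) => [->|]; [exists i2|exists i1].
have := mulf_neq0 (br_neq0 ij) d0; rewrite -(det3_liftw c); apply: contraNneq => ->.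
by rewrite det3E !mxE; apply/eqP; ring.
Qed.

(** The points of [r] are the lifts with [c = 0], so the lemmas on lifts apply to them too. *)
Lemma xv_lift w i : xv i = y (fun=> 0) w i.
Proof. by rewrite /y scale0r addr0. Qed.

Lemma lift_free c w i j : det3 e1 e2 w != 0 -> i != j -> free [:: y c w i; y c w j].
Proof.
by move=> d0 ij; apply: (@det3_free2 _ _ _ w); rewrite det3_liftw mulf_neq0 ?br_neq0.
Qed.

Lemma projective_image_qs2 : projective_image_of_quadrilateral_set r x -> q123 = 0.
Proof.
case=> P [Pr [p [k [k_inj p_inj _] pk] proj]].
pose w := vpick P.
have w0 : w != 0 by rewrite vpick0 -dimv_eq0 (eqP (point_dim P)).
have wP : w \in (P : {vspace _}) by exact: memv_pick.
have d0 : det3 e1 e2 w != 0.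
  by rewrite -(mem_line_det3 _ e_free e1r e2r) -(sub_pointP _ w0 wP).
(* As [x i] lies on the line joining [P] and [p i], its vector is a multiple of [w] plus a vector of
   [p i]. *)
have /fin_all_exists[c yp] i : exists t, xv i + t *: w \in (p i : {vspace _}).
  have [_ /(congr1 (fun V : {vspace _} => xv i \in V))] := proj i.
  rewrite xvx memv_cap => /andP[/memv_addP[u uP [v vp ->]] _].
  move: uP; rewrite (point_span w0 wP) => /vlineP[t ->].
  by exists (- t); rewrite scaleNr addrAC subrr add0r.
have yk l i : i \in combinatorial_line l -> y c w i \in k l.
  by move=> il; apply: (subvP (pk l i il)); apply: yp.
have coll l i j m : i \in combinatorial_line l -> j \in combinatorial_line l ->
    m \in combinatorial_line l -> [i j] * c m - [i m] * c j + [j m] * c i = 0.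
  move=> il jl ml; apply: (mulIf d0); rewrite mul0r -det3_lift.
  by apply: (@det3_coplanar _ (k l)); rewrite ?(eqP (line_dim _)) ?yk.
pose l156 : 'I_4 := @Ordinal 4 1 isT.
apply: (@qs2_collinear c).
- by apply: (coll l123); rewrite in_combinatorial_line.
- by apply: (coll l156); rewrite in_combinatorial_line.
- by apply: (coll (@Ordinal 4 2 isT)); rewrite in_combinatorial_line.
- by apply: (coll (@Ordinal 4 3 isT)); rewrite in_combinatorial_line.
have on l i il := yk l i (etrans (in_combinatorial_line l i) il).
apply/negP => /eqP D; have y6 : y c w i6 \in k l123.
  rewrite (@mem_line_det3 _ _ (y c w i1) (y c w i2)) ?on ?lift_free //.
  by rewrite det3_lift D mul0r.
have meet i : y c w i \in k l123 -> i \in combinatorial_line l156 ->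
    (k l123 :&: k l156)%VS = p i :> {vspace _}.
  move=> yi il; apply: meet_lines; first by move/k_inj.
  - by rewrite (sub_pointP _ (lift_neq0 c i d0) (yp i)).
  - exact: pk.
have /val_inj/p_inj // : val (p i1) = val (p i6).
by rewrite /= -(meet i1) ?on ?in_combinatorial_line // -(meet i6) ?in_combinatorial_line.
Qed.

Lemma lift_freew c w i : det3 e1 e2 w != 0 -> free [:: y c w i; w].
Proof.
move=> d0; have [j ij] : exists j, j != i.
  by case: (eqVneq i i1) => [->|]; [exists i2|exists i1; rewrite eq_sym].
have := mulf_neq0 (br_neq0 ij) d0; rewrite -(det3_liftw c) det3_free.
by rewrite free_cons => /andP[].
Qed.

(** The joining line contains [w], so it is not [r]; it also contains [xv i], the difference of the
    lift and [c i *: w]. *)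
Lemma lift_projects_to c w (P p : point F) i :
  det3 e1 e2 w != 0 -> w \in (P : {vspace _}) ->
  y c w i \in (p : {vspace _}) -> projects_to P r p (x i).
Proof.
move=> d0 wP yp; have y0 := lift_neq0 c i d0; have yw := lift_freew c i d0.
have w0 : w != 0 by case/andP: (etrans (esym (free_cons _ _)) yw) => _; rewrite seq1_free.
split.
  apply/eqP=> pP; move: yw; rewrite free_cons span_seq1 -(point_span w0 wP) -pP yp //.
have L : (P + p)%VS = span_line yw :> {vspace _}.
  by rewrite (point_span w0 wP) (point_span y0 yp) /= span_cons span_seq1 addvC.
have wL : w \in span_line yw by rewrite memv_span // !inE eqxx orbT.
have yL : y c w i \in span_line yw by rewrite memv_span // !inE eqxx.
rewrite L; apply: meet_lines.
- by move=> Lr; move: wL; rewrite Lr (mem_line_det3 _ e_free e1r e2r) (negPf d0).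
- rewrite (sub_pointP _ _ (xvx i)); last by rewrite (xv_lift w) lift_neq0.
  by rewrite -[xv i](addrK (c i *: w)) rpredB // rpredZ.
rewrite (sub_pointP _ _ (xvx i)); last by rewrite (xv_lift w) lift_neq0.
by rewrite rpredD // rpredZ.
Qed.

Lemma qs2_projective_image (P : point F) w :
  w \in (P : {vspace _}) -> det3 e1 e2 w != 0 ->
  q123 = 0 -> projective_image_of_quadrilateral_set r x.
Proof.
move=> wP d0 q0; have n i j := br_neq0 (i := i) (j := j).
have w0 : w != 0.
  by apply: contraNneq d0 => ->; rewrite det3E !mxE; apply/eqP; ring.
(* [c4] comes from the line 246; the line 345 is then the equation q = 0. *)
have [c4 c4E] : exists c4, c4 * [i2 i6] = [i1 i6] * [i2 i4].
  by exists ([i1 i6] * [i2 i4] / [i2 i6]); rewrite divfK ?n.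
pose c (i : 'I_6) := [:: 0; 0; 0; c4; [i1 i5]; [i1 i6]]`_i.
pose p i := span_point (lift_neq0 c i d0).
have yp i : y c w i \in (p i : {vspace _}) by exact: memv_line.
have on01 l : increasing_on l 0 != increasing_on l 1.
  by case: l => [[|[|[|[|//]]]] lP].
pose k l := span_line (lift_free c d0 (on01 l)).
have yk l i : i \in combinatorial_line l -> y c w i \in k l.
  have [<- _ _] := increasing_labelling l; case/imsetP=> s _ ->.
  have y0k : y c w (increasing_on l 0) \in k l by rewrite memv_span // !inE eqxx.
  have y1k : y c w (increasing_on l 1) \in k l by rewrite memv_span // !inE eqxx orbT.
  case: s => [[|[|[|//]]] sP].
  - by rewrite (_ : Ordinal sP = 0) //; apply/val_inj.
  - by rewrite (_ : Ordinal sP = 1) //; apply/val_inj.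
  rewrite (mem_line_det3 _ (lift_free c d0 (on01 l)) y0k y1k) det3_lift mulf_eq0.
  apply/orP; left; apply/eqP; rewrite /c.
  case: l {y0k y1k} => [[|[|[|[|//]]]] lP]; rewrite /increasing_on /tnth /=.
  - by ring.
  - by ring.
  - by rewrite mulr0 addr0 mulrC -c4E mulrC subrr.
  - apply: (mulIf (n i2 i6 isT)); rewrite mul0r -[RHS]q0.
    transitivity ([i1 i5] * [i2 i6] * [i3 i4] - c4 * [i2 i6] * [i3 i5]); first by ring.
    by rewrite c4E /q123 /qs2 /=; ring.
have c4_neq0 : c4 != 0.
  apply: contraNneq (mulf_neq0 (n i1 i6 isT) (n i2 i4 isT)) => c40.
  by rewrite -c4E c40 mul0r.
have c_neq0 (i : 'I_6) : (3 <= i)%N -> c i != 0.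
  by case: i => [[|[|[|[|[|[|//]]]]]] iP] //= _; rewrite /c /= ?n.
have c_eq0 (i : 'I_6) : (i < 3)%N -> c i = 0.
  by case: i => [[|[|[|[|[|[|//]]]]]] iP] //= _.
(* A coincidence of two lines would make the lifts of [i], [j], [t] collinear, but [c] vanishes at
   [i] and [j] only, so their determinant is [[i j] * c t] times a nonzero factor. *)
have k_inj : injective k.
  move=> l m klm; apply/eqP/negPn/negP => /two_on_first_line[i [j [t [i3 j3 ij t3 on]]]].
  have yl s : s \in [:: i; j; t] -> y c w s \in k l.
    by move/on=> /orP[/yk //|/yk]; rewrite klm.
  have yi : y c w i \in k l by rewrite yl ?inE ?eqxx.
  have yj : y c w j \in k l by rewrite yl ?inE ?eqxx ?orbT.
  have : y c w t \in k l by rewrite yl ?inE ?eqxx ?orbT.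
  rewrite (mem_line_det3 _ (lift_free c d0 ij) yi yj) det3_lift (c_eq0 i) // (c_eq0 j) //.
  rewrite !mulr0 subr0 addr0 !mulf_eq0.
  by rewrite (negPf d0) (negPf (n _ _ ij)) (negPf (c_neq0 _ t3)).
have p_inj : injective p.
  move=> i j pij; apply/eqP/negPn/negP => /(lift_free c d0).
  by rewrite free_cons span_seq1 -[<[_]>%VS]/(p j : {vspace _}) -pij yp.
have pk l i : i \in combinatorial_line l -> (p i <= k l)%VS.
  by move=> /yk yl; rewrite (sub_pointP _ (lift_neq0 c i d0)).
have meet l m i : l != m -> i \in combinatorial_line l -> i \in combinatorial_line m ->
    (k l :&: k m)%VS = p i :> {vspace _}.
  by move=> /eqP lm il im; apply: meet_lines; rewrite ?pk // => /k_inj.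
exists P; split.
  by rewrite (sub_pointP _ w0 wP) (mem_line_det3 _ e_free e1r e2r).
exists p; last by move=> i; apply: lift_projects_to d0 wP (yp i).
exists k => //; split=> // Q; split=> [[i <-]|[l [m [lm kQ]]]].
  by have [l [m [lm il im]]] := two_lines i; exists l, m; rewrite (meet _ _ i).
have [i /andP[il im]] := common_point lm.
by exists i; apply/val_inj; rewrite /= -kQ (meet _ _ i).
Qed.

Lemma QS_qs2 h pl pm P1 P2 P3 : (forall i, h (x i) = xv i) ->
  QS h x pl pm P1 P2 P3 =
  qs2 a b pl pm * (det3 e1 e2 (h P1) * det3 e1 e2 (h P2) * det3 e1 e2 (h P3)).
Proof.
move=> hx; have br i j P : bracket h (x i) (x j) P = [i j] * det3 e1 e2 (h P).
  by rewrite /bracket !hx (xv_lift (h P) i) (xv_lift (h P) j) -/(det3 _ _ _) det3_liftw.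
by rewrite /QS !br /qs2; ring.
Qed.

End Configuration.

(** * Coordinates on [r] and a frame point off [r] *)

Section Coordinates.
Variables (F : fieldType) (r : line F).

Lemma line_basis : exists e1 e2, [/\ free [:: e1; e2], e1 \in r & e2 \in r].
Proof.
have := vbasisP r; case: (vbasis r : seq _) (size_tuple (vbasis r)).
  by rewrite (eqP (line_dim r)).
move=> e1 [|e2 [|//]]; rewrite ?(eqP (line_dim r)) // => _ rE.
exists e1, e2; split; rewrite ?(basis_free rE) //;
  by apply: (basis_mem rE); rewrite !inE eqxx ?orbT.
Qed.

Lemma line_coordinates e1 e2 u : free [:: e1; e2] -> e1 \in r -> e2 \in r -> u \in r ->
  exists t : F * F, u = t.1 *: e1 + t.2 *: e2.
Proof.
move=> e12 e1r e2r; rewrite (line_span e12 e1r e2r) span_cons span_seq1.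
by move=> /memv_addP[_ /vlineP[s ->] [_ /vlineP[t ->] ->]]; exists (s, t).
Qed.

(** Otherwise three independent vectors would lie in a space of dimension 2. *)
Lemma frame_off_line (R_ : 'I_3 -> point F) U : frame_of_reference R_ U ->
  exists i, ~~ (R_ i <= r)%VS.
Proof.
case=> v [v_free vR _]; apply/existsP; rewrite -negb_forall; apply/negP => /forallP Rr.
have : (<<v>> <= r)%VS.
  apply/span_subvP => u /tnthP[i ->].
  by apply: (subvP (Rr i)); rewrite -vR memv_line.
by move/dimvS; rewrite (eqP v_free) size_tuple (eqP (line_dim r)).
Qed.

Lemma br2_neq0 (x : 'I_6 -> point F) (e1 e2 : 'cV[F]_3) (a b : 'I_6 -> F) : injective x ->
  (forall i, a i *: e1 + b i *: e2 != 0) ->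
  (forall i, a i *: e1 + b i *: e2 \in (x i : {vspace _})) ->
  forall i j, i != j -> br2 a b i j != 0.
Proof.
move=> x_inj v0 vx i j; apply: contraNneq => ij0; apply/eqP/x_inj.
(* A zero bracket makes the coordinates proportional; [s] is [a j], or [b j] when [a j] is zero,
   since they cannot both vanish. *)
have [s [t [st0 E]]] : exists s t : F, s != 0 /\
    s *: (a i *: e1 + b i *: e2) = t *: (a j *: e1 + b j *: e2).
  have ab : a i * b j = a j * b i by apply/subr0_eq.
  case: (eqVneq (a j) 0) => [aj|aj].
    exists (b j), (b i); split.
      by apply: contraNneq (v0 j) => bj; rewrite aj bj !scale0r addr0.
    by rewrite !scalerDr !scalerA [_ * a i]mulrC ab [b j * _]mulrC [b i * _]mulrC.
  by exists (a j), (a i); split => //; rewrite !scalerDr !scalerA ab [_ * a i]mulrC.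
apply: (@point_eq _ _ _ (s *: (a i *: e1 + b i *: e2))).
- by rewrite scaler_eq0 negb_or st0 v0.
- by rewrite rpredZ.
- by rewrite E rpredZ.
Qed.

End Coordinates.

(** * The cycle of implications between the five statements *)

Theorem theorem4p7 (R : realType) (r : line R[i])
    (x : 'I_6 -> point R[i])
    (x_distinct : injective x) (x_on_r : forall i, (x i <= r)%VS)
    (R_ : 'I_3 -> point R[i]) (U : point R[i])
    (R_U_frame : frame_of_reference R_ U)
    (h : point R[i] -> 'cV[R[i]]_3) (h_coord : homogeneous_coordinates h)
    (pl pm : 'I_4 -> 'I_3 -> 'I_6)
    (pl_pm : forall l, QS_labelling l (pl l) (pm l)) :
  [<-> projective_image_of_quadrilateral_set r x;
       forall l P1 P2 P3, QS h x (pl l) (pm l) P1 P2 P3 = 0;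
       forall l i j k, QS h x (pl l) (pm l) (R_ i) (R_ j) (R_ k) = 0;
       forall i j k, QS h x (pl l123) (pm l123) (R_ i) (R_ j) (R_ k) = 0;
       forall i j k : 'I_3, (i <= j <= k)%N ->
         QS h x (pl l123) (pm l123) (R_ i) (R_ j) (R_ k) = 0].
Proof.
have [e1 [e2 [e12 e1r e2r]]] := line_basis r.
have h0 P : h P != 0 by case: (h_coord P).
have hP P : h P \in (P : {vspace _}) by case: (h_coord P).
(* The coordinates on [r] are read off the representatives given by [h], so that [QS] factors
   exactly and not just up to a scalar. *)
have /fin_all_exists[t hx] i : exists t, h (x i) = t.1 *: e1 + t.2 *: e2.
  by apply: (line_coordinates e12 e1r e2r); rewrite -(sub_pointP _ (h0 _) (hP _)).
pose a i := (t i).1; pose b i := (t i).2.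
have xvx i : a i *: e1 + b i *: e2 \in (x i : {vspace _}) by rewrite -hx.
have br0 : forall i j, i != j -> br2 a b i j != 0.
  by apply: br2_neq0 x_distinct _ xvx => i; rewrite -hx.
have QSE l P1 P2 P3 : QS h x (pl l) (pm l) P1 P2 P3 = qs2 a b (pl l) (pm l) *
    (det3 e1 e2 (h P1) * det3 e1 e2 (h P2) * det3 e1 e2 (h P3)) by exact: QS_qs2.
have qs2_0 l : (qs2 a b (pl l) (pm l) == 0) =
    (qs2 a b (increasing_on l123) (increasing_off l123) == 0).
  exact: qs2_labelling (pl_pm l) (increasing_labelling l123).
tfae=> [img l P1 P2 P3|QS0 l i j k|QS0 i j k|QS0 i j k _|QS0]; rewrite ?QS0 //.
  have /eqP := projective_image_qs2 e12 e1r e2r xvx br0 img.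
  by rewrite -(qs2_0 l) QSE => /eqP ->; rewrite mul0r.
have [i Ri] := frame_off_line r R_U_frame.
have d0 : det3 e1 e2 (h (R_ i)) != 0.
  by rewrite -(mem_line_det3 _ e12 e1r e2r) -(sub_pointP _ (h0 _) (hP _)).
apply: (qs2_projective_image e12 e1r e2r xvx br0 (hP (R_ i)) d0).
(* The diagonal triple is allowed by the weak inequalities, and [R_ i] off [r] lets the three
   determinant factors be cancelled. *)
apply/eqP; rewrite -(qs2_0 l123); have := QS0 i i i; rewrite leqnn => /(_ isT)/eqP.
by rewrite QSE !mulf_eq0 (negPf d0) !orbF.
Qed.
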